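(* Let $q$ be a complex number with $q\neq 0,1$, let $m,r$ be complex numbers, and write $[j]_q=\frac{q^j-1}{q-1}$. For all integers $0\le k\le n$, the $(q,r)$-Whitney numbers of the second kind satisfy $$W_{m,r,q}(n,k)=q^{\binom{k}{2}}\sum_{c_0+c_1+\cdots+c_k=n-k}\ \prod_{j=0}^{k}\big(m[j]_q+r\big)^{c_j},$$ where the sum runs over all tuples $(c_0,\dots,c_k)$ of non-negative integers with $c_0+\cdots+c_k=n-k$.
   Context: The $(q,r)$-Whitney numbers of the second kind $W_{m,r,q}(n,k)$ are defined as the coefficients in $(ma^\dagger a+r)^n=\sum_{k=0}^{n}m^kW_{m,r,q}(n,k)(a^\dagger)^k a^k$, where $a^\dagger,a$ are $q$-boson operators satisfying $aa^\dagger-qa^\dagger a=1$. Equivalently, they are the unique numbers with $W_{m,r,q}(0,0)=1$, $W_{m,r,q}(n,k)=0$ for $k<0$ or $k>n$, and the recurrence $W_{m,r,q}(n+1,k)=q^{k-1}W_{m,r,q}(n,k-1)+(m[k]_q+r)W_{m,r,q}(n,k)$ for $n\ge 0$. *)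

(* Defs.v *)
From HB Require Import structures.
From mathcomp Require Import all_boot all_order all_algebra.
From mathcomp Require Import ring.

Set Implicit Arguments.
Unset Strict Implicit.
Unset Printing Implicit Defensive.

Import Order.TTheory GRing.Theory Num.Theory.

Local Open Scope ring_scope.

Section QRWhitney.
Variables (F : fieldType) (m r q : F).

Definition qnum (j : int) : F := (q ^ j - 1) / (q - 1).

(* W(0,0) = 1 and W(n+1,k) = q^(k-1) W(n,k-1) + (m[k]_q + r) W(n,k) for all
   integers k.  The vanishing for k < 0 or k > n follows (qrWhitney_out), and
   these properties characterize W (qrWhitney_unique); the link with the
   q-boson expansion is qrWhitney_boson. *)
Fixpoint qrWhitney (n : nat) (k : int) : F :=
  if n is n'.+1 then
    q ^ (k - 1) * qrWhitney n' (k - 1) + (m * qnum k + r) * qrWhitney n' k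
  else (k == 0)%:R.

Lemma qrWhitney_out n (k : int) : (k < 0) || (n%:Z < k) -> qrWhitney n k = 0.
Proof.
elim: n k => [|n IH] k /= hk.
  by case: eqP hk => // ->; rewrite ltxx.
rewrite !IH ?mulr0 ?addr0 //; case/orP: hk => hk; apply/orP.
- by left.
- by right; apply: le_lt_trans hk; rewrite lez_nat.
- by left; apply: le_lt_trans hk; rewrite gerBl.
- by right; rewrite ltrBrDr -PoszD addn1.
Qed.

Lemma qrWhitney_unique (W : nat -> int -> F) :
    W 0%N 0 = 1 ->
    (forall n (k : int), (k < 0) || (n%:Z < k) -> W n k = 0) ->
    (forall n (k : int),
       W n.+1 k = q ^ (k - 1) * W n (k - 1) + (m * qnum k + r) * W n k) ->
  forall n k, W n k = qrWhitney n k.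
Proof.
move=> W0 Wout Wrec; elim=> [|n IH] k /=; last by rewrite Wrec !IH.
case: eqP => [->//|/eqP k0]; apply: Wout.
by rewrite -neq_lt.
Qed.

Lemma qnumS (i : nat) : q != 0 -> q != 1 -> qnum i.+1 = q ^+ i + qnum i.
Proof.
move=> q0 q1; rewrite /qnum -!exprnP.
have h : q - 1 != 0 by rewrite subr_eq0.
apply: (mulIf h); rewrite [RHS]mulrDl !divfK // mulrBr mulr1 exprSr.
by rewrite addrA subrK.
Qed.

Lemma qnum0 : qnum 0 = 0.
Proof. by rewrite /qnum expr0z subrr mul0r. Qed.

Lemma qnum1 : q != 1 -> qnum 1 = 1.
Proof. by move=> q1; rewrite /qnum expr1z divff // subr_eq0. Qed.

(* Expansion of (m a^+ a + r)^n for a q-boson pair b = a^+, a in an algebra.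
   When m = 0 it does not determine W(n,k) for k > 0, hence the definition of
   qrWhitney by its recurrence. *)
Lemma qrWhitney_boson (A : algType F) (a b : A) (n : nat) :
    q != 0 -> q != 1 -> a * b - q *: (b * a) = 1 ->
  (m *: (b * a) + r%:A) ^+ n =
    \sum_(k < n.+1) (m ^+ k * qrWhitney n k%:Z) *: (b ^+ k * a ^+ k).
Proof.
move=> q0 q1 /(canRL (subrK _)) ab.
have abk k : a * b ^+ k.+1 = q ^+ k.+1 *: (b ^+ k.+1 * a) + qnum k.+1 *: b ^+ k.
  elim: k => [|k IH].
    rewrite qnum1 //.
    by rewrite !expr1 expr0 scale1r ab addrC.
  rewrite [in LHS]exprSr mulrA IH mulrDl -!scalerAl -(mulrA (b ^+ k.+1)) ab.
  rewrite mulrDr mulr1 -scalerAr scalerDr scalerA -exprSr mulrA -!exprSr.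
  by rewrite (qnumS k.+1) // scalerDl -!addrA addrCA addrC -!addrA.
have step k : b * a * (b ^+ k * a ^+ k) =
    q ^+ k *: (b ^+ k.+1 * a ^+ k.+1) + qnum k *: (b ^+ k * a ^+ k).
  case: k => [|k].
    by rewrite qnum0 !expr0 !expr1 !mulr1 scale0r addr0 scale1r.
  rewrite -mulrA (mulrA a) abk mulrDl mulrDr -!scalerAl -!scalerAr.
  by rewrite -mulrA -exprS !mulrA -!exprS.
elim: n => [|n IH].
  by rewrite big_ord1 !expr0 /= !mulr1 scale1r.
rewrite exprS IH mulr_sumr.
pose E k := b ^+ k * a ^+ k.
have W_lt : qrWhitney n (0 - 1) = 0 by rewrite qrWhitney_out.
have W_gt : qrWhitney n n.+1%:Z = 0 by rewrite qrWhitney_out // ltz_nat ltnSn orbT.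
transitivity (\sum_(k < n.+1) ((m ^+ k.+1 * (q ^+ k * qrWhitney n k%:Z)) *: E k.+1)
   + \sum_(k < n.+1) ((m ^+ k * ((m * qnum k + r) * qrWhitney n k%:Z)) *: E k)).
  rewrite -big_split; apply: eq_bigr => k _ /=.
  rewrite -scalerAr mulrDl -!scalerAl mul1r step !scalerDr !scalerA -addrA -scalerDl /E.
  by congr (_ *: _ + _ *: _); rewrite ?exprS; ring.
transitivity (\sum_(k < n.+2) ((m ^+ k * (q ^ (k%:Z - 1) * qrWhitney n (k%:Z - 1))) *: E k)
   + \sum_(k < n.+2) ((m ^+ k * ((m * qnum k + r) * qrWhitney n k%:Z)) *: E k)).
  rewrite [in X in _ = X + _]big_ord_recl [in X in _ = _ + X]big_ord_recr /=.
  rewrite W_lt W_gt !mulr0 !scale0r add0r addr0; congr (_ + _).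
  by apply: eq_bigr => k _; rewrite /bump leq0n add1n intS [1 + _]addrC addrK.
rewrite -big_split; apply: eq_bigr => k _ /=.
by rewrite -scalerDl -mulrDr.
Qed.

End QRWhitney.

(* Main.v *)
(* The complete homogeneous sum of degree d in x_0, ..., x_(k-1) is the
   coefficient of X^d in the product of the geometric series of the x_j X.
   Multiplying the last factor by 1 - x_k X gives the recurrence
   h_(k+1)(d+1) = h_k(d+1) + x_k h_(k+1)(d), which is the recurrence of the
   Whitney numbers for x_j = m[j]_q + r; the factors q^(k-1) build up q^C(k,2).
   The series are truncated at a degree B >= d, which does not affect the
   coefficient of X^d and matches the bound on the c_j in the sum. *)
Require Import Defs.
From mathcomp Require Import all_boot all_order all_algebra.
From mathcomp Require Import reals complex.
From mathcomp Require Import ring.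
Import Order.TTheory GRing.Theory Num.Theory.
Local Open Scope ring_scope.

Definition geom_poly (R : comNzRingType) (B : nat) (x : R) : {poly R} :=
  \sum_(i < B.+1) x ^+ i *: 'X^i.

Definition homog_poly (R : comNzRingType) (B : nat) (x : nat -> R) (k : nat) : {poly R} :=
  \prod_(j < k) geom_poly R B (x j).

(** Telescoping gives [(1 - x X) G = 1 - (x X)^(B+1)] for the truncated series [G]; it is solved for
    [G] so that one rewrite produces the recurrence. *)
Lemma geom_polyE (R : comNzRingType) (B : nat) (x : R) :
  geom_poly R B x = 1 + x *: 'X * geom_poly R B x - (x *: 'X) ^+ B.+1.
Proof.
have -> : geom_poly R B x = \sum_(i < B.+1) (x *: 'X) ^+ i.
  by apply: eq_bigr => i _; rewrite exprZn.
rewrite -[_ ^+ B.+1](subrK 1) subrX1; ring.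
Qed.

Lemma coef0_homog_poly (R : comNzRingType) (B : nat) (x : nat -> R) (k : nat) :
  (homog_poly R B x k)`_0 = 1.
Proof.
elim: k => [|k IH]; first by rewrite /homog_poly big_ord0 coef1.
rewrite /homog_poly big_ord_recr coef0M -/(homog_poly R B x k) IH mul1r.
rewrite geom_polyE !(coefB, coefD) -scalerAl coefZ coefXM coef1 exprZn coefZ coefXn.
by rewrite /= !mulr0 subr0 addr0.
Qed.

Lemma coefS_homog_poly (R : comNzRingType) (B : nat) (x : nat -> R) (k d : nat) :
  (d < B)%N ->
  (homog_poly R B x k.+1)`_d.+1 =
    (homog_poly R B x k)`_d.+1 + x k * (homog_poly R B x k.+1)`_d.
Proof.
move=> ltdB; have homogS : homog_poly R B x k.+1 = homog_poly R B x k * geom_poly R B (x k).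
  by rewrite /homog_poly big_ord_recr.
rewrite {1}homogS geom_polyE mulrBr mulrDr mulr1 mulrCA -homogS.
rewrite exprZn -scalerAl -scalerAr !(coefB, coefD, coefZ) coefXM coefMXn.
(* The truncation term starts in degree [B.+1 > d.+1], so it contributes nothing. *)
by rewrite !ltnS ltdB mulr0 subr0.
Qed.

(** Expanding the product picks one exponent [c j] from each factor. *)
Lemma coef_homog_poly (R : comNzRingType) (B : nat) (x : nat -> R) (k d : nat) :
  (homog_poly R B x k)`_d =
    \sum_(c : {ffun 'I_k -> 'I_B.+1} | (\sum_(j < k) c j == d)%N)
      \prod_(j < k) x j ^+ c j.
Proof.
rewrite /homog_poly /geom_poly bigA_distr_bigA coef_sum [RHS]big_mkcond /=.
apply: eq_bigr => c _.
by rewrite scaler_prod -expr_sum coefZ coefXn eq_sym; case: eqP; rewrite ?mulr1 ?mulr0.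
Qed.

(** With n = k + d both recurrences reach (k+1, d+1) from (k, d+1) and (k+1, d), hence the nested
    induction. *)
Lemma qrWhitney_homog_poly (F : fieldType) (m r q : F) (B k d : nat) :
  (d <= B)%N ->
  qrWhitney m r q (k + d) k%:Z =
    q ^+ 'C(k, 2) * (homog_poly F B (fun j => m * qnum q j%:Z + r) k.+1)`_d.
Proof.
elim: k d => [|k IHk]; elim=> [|d IHd] ledB.
- by rewrite coef0_homog_poly !mulr1.
- rewrite add0n bin0n expr0 mul1r coefS_homog_poly // /homog_poly big_ord0 coef1 add0r /=.
  rewrite qrWhitney_out // mulr0 add0r -[d in qrWhitney _ _ _ d _]add0n IHd 1?ltnW //.
  by rewrite expr0 mul1r.
(* For d = 0 only [q^k W(k,k)] survives, and C(k+1,2) = C(k,2) + k. *)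
- have W_gt : qrWhitney m r q k k.+1%:Z = 0.
    by rewrite qrWhitney_out // ltz_nat ltnSn orbT.
  rewrite addn0 /= W_gt mulr0 addr0 intS [1 + _]addrC addrK.
  rewrite -[X in qrWhitney _ _ _ X _]addn0 IHk //.
  by rewrite !coef0_homog_poly !mulr1 -exprnP -exprD binS bin1 addnC.
- rewrite addSn /= -[in X in _ + _ * X]addSnnS IHd 1?ltnW //.
  rewrite [X in q ^ (X - 1)]intS [X in qrWhitney _ _ _ _ (X - 1)]intS [1 + _]addrC addrK IHk //.
  rewrite [in RHS]coefS_homog_poly // -exprnP binS bin1 addnC exprD; ring.
Qed.

Theorem theorem3 (R : realType) (m r q : R[i]) (n k : nat)
    (hq0 : q != 0) (hq1 : q != 1) (hkn : (k <= n)%N) :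
  qrWhitney m r q n k%:Z =
  q ^+ 'C(k, 2) *
    \sum_(c : {ffun 'I_k.+1 -> 'I_(n - k).+1} | (\sum_(j < k.+1) c j == n - k)%N)
      \prod_(j < k.+1) (m * qnum q j%:Z + r) ^+ c j.
Proof.
(* Here the bound [B] is the degree [n - k] itself. *)
rewrite -(coef_homog_poly _ _ (fun j => m * qnum q j%:Z + r)).
by rewrite -qrWhitney_homog_poly // subnKC.
Qed.
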